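(* Let $G$ and $H$ be Polish groups and let $B\subseteq G\times H$ be a Borel set. Consider the conditions: (1) there exist a Haar null set $E\subseteq H$ and a Borel probability measure $\mu$ on $G$ such that every $h\in H\setminus E$ and every $g_1,g_2\in G$ satisfy $\mu(g_1B^hg_2)=0$; (2) $B$ is Haar null in the group $G\times H$; (3) there exists a Haar null set $E\subseteq H$ such that for every $h\in H\setminus E$ the section $B^h$ has Haar measure zero in $G$. Then (1) implies (2) (for arbitrary Polish $G$). If moreover $G$ is locally compact, then (1), (2) and (3) are all equivalent.
   Context: A Polish group is a topological group whose topology is separable and completely metrizable; $G\times H$ carries the product group structure and topology. A set $A$ in a Polish group $\Gamma$ is Haar null if there are a Borel set $B'\supseteq A$ and a Borel probability measure $\nu$ on $\Gamma$ with $\nu(xB'y)=0$ for all $x,y\in\Gamma$. For $h\in H$, $B^h=\{g\in G:(g,h)\in B\}$. In a locally compact group $G$, a set has Haar measure zero if it is contained in a Borel set of measure zero for a (any) left Haar measure on $G$ (equivalently for any right Haar measure). *)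

(* Defs.v *)
From HB Require Import structures.
From mathcomp Require Import all_boot all_order all_algebra.
From mathcomp Require Import all_classical all_reals all_analysis.
Set Implicit Arguments. Unset Strict Implicit. Unset Printing Implicit Defensive.
Import Order.TTheory GRing.Theory Num.Theory.
(* make the product of two pointed topological spaces a ptopologicalType *)
HB.saturate prod.

Local Open Scope classical_set_scope.
Local Open Scope ring_scope.

Notation borelT T := (g_sigma_algebraType (@open T)).

Definition borel (T : ptopologicalType) (A : set T) : Prop := <<s @open T >> A.

Definition is_group (T : Type) (mul : T -> T -> T) (inv : T -> T) (one : T) :=
  [/\ (forall x y z, mul x (mul y z) = mul (mul x y) z),
      (forall x, mul one x = x), (forall x, mul x one = x),
      (forall x, mul (inv x) x = one) & (forall x, mul x (inv x) = one)].

Definition separable (T : topologicalType) : Prop :=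
  exists D : set T, countable D /\ dense D.

Definition completely_metrizable (R : realType) (T : topologicalType) : Prop :=
  exists d : T -> T -> R,
    [/\ (forall x y, 0 <= d x y) /\ (forall x y, d x y = 0 <-> x = y),
        (forall x y, d x y = d y x),
        (forall x y z, d x z <= d x y + d y z),
        (forall A : set T, open A <->
            (forall x, A x -> exists2 e : R, 0 < e & [set y | d x y < e] `<=` A))
      & (forall u : nat -> T,
           (forall e : R, 0 < e -> exists N : nat, forall m n : nat,
               (N <= m)%N -> (N <= n)%N -> d (u m) (u n) < e) ->
           exists l : T, u n @[n --> \oo] --> l)].

Definition polish_group (R : realType) (T : topologicalType)
    (mul : T -> T -> T) (inv : T -> T) (one : T) : Prop :=
  [/\ is_group mul inv one,
      continuous (fun p : T * T => mul p.1 p.2),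
      continuous inv,
      separable T & completely_metrizable R T].

Definition twosided (T : Type) (mul : T -> T -> T) (x : T) (A : set T) (y : T)
  : set T := [set mul (mul x a) y | a in A].

Definition haar_null (R : realType) (T : ptopologicalType)
    (mul : T -> T -> T) (A : set T) : Prop :=
  exists B' : set T, [/\ borel B', A `<=` B' &
    exists nu : probability (borelT T) R,
      forall x y : T, nu (twosided mul x B' y) = 0%E].

Definition left_haar_measure (R : realType) (T : ptopologicalType)
    (mul : T -> T -> T) (lam : {measure set (borelT T) -> \bar R}) : Prop :=
  [/\ (0 < lam [set: T])%E,
      (forall (g : T) (A : set T), borel A -> lam [set mul g a | a in A] = lam A),
      (forall K : set T, compact K -> (lam K < +oo)%E),
      (forall A : set T, borel A ->
         lam A = ereal_inf [set lam U | U in [set U : set T | open U /\ A `<=` U]])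
    & (forall U : set T, open U ->
         lam U = ereal_sup [set lam K | K in [set K : set T | compact K /\ K `<=` U]])].

Definition haar_measure_zero (R : realType) (T : ptopologicalType)
    (lam : {measure set (borelT T) -> \bar R}) (A : set T) : Prop :=
  exists2 B' : set T, borel B' /\ A `<=` B' & lam B' = 0%E.

Definition hsection (G H : Type) (B : set (G * H)) (h : H) : set G :=
  [set g | B (g, h)].

Definition prod_mul (G H : Type) (mulG : G -> G -> G) (mulH : H -> H -> H)
  (p q : G * H) : G * H := (mulG p.1 q.1, mulH p.2 q.2).

Definition loc_compact (T : topologicalType) : Prop :=
  forall x : T, exists K : set T, compact K /\ nbhs x K.

(* Main.v *)
(** If [mu] and [nu] witness (1), then [mu \x nu] witnesses (2): its value on a
    two-sided translate of [B] is the integral over [nu] of the measures of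
    two-sided translates of sections [B^h], and the exceptional [h] lie in a
    translate of [E].

    For (2) => (3), let [nu] witness (2) for a Borel set [B'] containing [B]
    and let [lam] be a left Haar measure. By Fubini on
    [{(g, (a, b)) : (a g, x^-1 b y^-1) \in B'}], whose [g]-sections are
    two-sided translates of [B'], for [nu]-almost all [(a, b)] the set
    [{g : (a g, x^-1 b y^-1) \in B'}] is [lam]-null. It is a left translate of
    a section of [B'], so the projection of [nu] to [H] witnesses that
    [{h : lam (B'^h) != 0}] is Haar null. Translating on the right by
    [(g^-1, y)], rather than on the left, is what makes left invariance enough.

    For (3) => (1), take a probability [mu] absolutely continuous with respect
    to [lam]; right translates of [lam]-null sets are [lam]-null. *)

Require Import Defs.
From HB Require Import structures.
From mathcomp Require Import all_boot all_order all_algebra.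
From mathcomp Require Import all_classical all_reals all_analysis.
From mathcomp Require Import measurable_realfun.
Set Implicit Arguments.
Unset Strict Implicit.
Unset Printing Implicit Defensive.
Import Order.TTheory GRing.Theory Num.Theory.
Local Open Scope classical_set_scope.
Local Open Scope ring_scope.

(** * Countable bases and Borel sets of products *)

(** Second countability as an enumeration; repetitions and empty members are allowed. *)
Definition open_base (T : topologicalType) (U : nat -> set T) :=
  (forall n, open (U n)) /\
  forall (A : set T) x, open A -> A x -> exists2 n, U n x & U n `<=` A.

Lemma metric_open_ball (R : realType) (T : topologicalType) (d : T -> T -> R) :
  (forall x y z, d x z <= d x y + d y z) ->
  (forall A : set T, open A <-> (forall x, A x ->
     exists2 e : R, 0 < e & [set y | d x y < e] `<=` A)) ->
  forall x e, open [set y | d x y < e].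
Proof.
move=> dtri dopen x e; apply/dopen => y /= xye.
exists (e - d x y); first by rewrite subr_gt0.
move=> z /= yz; apply: le_lt_trans (dtri _ y _) _.
by rewrite addrC -ltrBrDr.
Qed.

Lemma polish_base (R : realType) (T : ptopologicalType) :
  separable T -> completely_metrizable R T ->
  exists U : nat -> set T, open_base U.
Proof.
move=> [D [cD dD]] [d [[d0 d0P] dsym dtri dopen _]].
have ballo := metric_open_ball dtri dopen.
move/countable_injP : cD => [f finj].
(* The point of [D] numbered [n] by the injection [f], or the default [point] if there is none. *)
pose s n := xget point (D `&` f @^-1` [set n]).
have sf x : D x -> s (f x) = x.
  move=> Dx; rewrite /s; case: xgetP => [y _ [Dy /= yx]|/(_ x)[]//].
  by apply: finj => //; rewrite inE.
pose F (p : nat * nat) := [set y | d (s p.1) y < p.2.+1%:R^-1].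
exists (fun n => if unpickle n is Some p then F p else set0); split.
  by move=> n; case: unpickle => [p|]; [exact: ballo|exact: open0].
move=> A x /dopen oA /oA[e e0 eA].
(* With radius below [e / 2], the ball around a dense [y] this close to [x] contains [x] and stays
   in [A]. *)
have [k ke] : exists k : nat, k.+1%:R^-1 < e / 2.
  have e2 : 0 < e / 2 by rewrite divr_gt0.
  exists (Num.truncn (e / 2)^-1).
  by rewrite invf_plt ?posrE//; exact: truncnS_gt.
have [|y [/= xy Dy]] := dD [set y | d x y < k.+1%:R^-1] _ (ballo _ _).
  by exists x => /=; rewrite (d0P x x).2// invr_gt0.
exists (pickle (f y, k)); rewrite pickleK /F /= sf//; first by rewrite dsym.
move=> z /= yz; apply: eA => /=; apply: le_lt_trans (dtri _ y _) _.
by rewrite (splitr e) ltrD// (lt_trans _ ke).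
Qed.

(** Makes compact sets closed, hence Borel. *)
Lemma metrizable_hausdorff (R : realType) (T : topologicalType) :
  completely_metrizable R T -> hausdorff_space T.
Proof.
move=> [d [[d0 d0P] dsym dtri dopen _]].
have ballo := metric_open_ball dtri dopen.
rewrite open_hausdorff => x y xy.
have dxy : 0 < d x y.
  by rewrite lt_neqAle d0 andbT eq_sym; apply/eqP => /d0P; exact/eqP.
have h0 : 0 < d x y / 2 by rewrite divr_gt0.
exists ([set z | d x z < d x y / 2], [set z | d y z < d x y / 2]).
  by rewrite !inE /= (d0P x x).2// (d0P y y).2.
split; [exact: ballo|exact: ballo|].
apply/eqP; rewrite -subset0 => z /= [xz yz].
have := dtri x z y; rewrite leNgt => /negP; apply.
by rewrite (splitr (d x y)) ltrD// dsym.
Qed.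

Lemma open_base_box (T1 T2 : topologicalType)
    (U : nat -> set T1) (V : nat -> set T2) (A : set (T1 * T2)) x y :
  open_base U -> open_base V -> open A -> A (x, y) ->
  exists i j, [/\ U i x, V j y & U i `*` V j `<=` A].
Proof.
move=> [_ bU] [_ bV] oA Axy.
have [[P Q] /= [xP yQ] PQA] : nbhs (x, y) A by exact: open_nbhs_nbhs.
move: xP yQ; rewrite !nbhsE => -[P' [oP' P'x] P'P] [Q' [oQ' Q'y] Q'Q].
have [i Uix UiP] := bU _ _ oP' P'x.
have [j Vjx VjQ] := bV _ _ oQ' Q'y.
exists i, j; split=> // -[a b] /= [Ua Vb]; apply: PQA; split=> /=.
  exact/P'P/UiP.
exact/Q'Q/VjQ.
Qed.

(** Lets the measurability lemmas be iterated, as Fubini on [G * (G * H)] requires. *)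
Lemma prod_base (T1 T2 : ptopologicalType)
    (U : nat -> set T1) (V : nat -> set T2) :
  open_base U -> open_base V ->
  exists W : nat -> set (T1 * T2), open_base W.
Proof.
move=> bU bV.
exists (fun n => if unpickle n is Some p then U p.1 `*` V p.2 else set0); split.
  move=> n; case: unpickle => [[i j]|/=]; last exact: open0.
  have -> : U i `*` V j = fst @^-1` U i `&` snd @^-1` V j by [].
  apply: openI; apply: open_comp => //; first by move=> ? _; exact: cvg_fst.
  - by case: bU.
  - by move=> ? _; exact: cvg_snd.
  - by case: bV.
move=> A [x y] oA Axy.
have [i [j [Ui Vj sA]]] := open_base_box bU bV oA Axy.
by exists (pickle (i, j)); rewrite pickleK.
Qed.

(** An open set is the union of the countably many basic boxes inside it. *)
Lemma open_prod_measurable (T1 T2 : ptopologicalType)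
    (U : nat -> set T1) (V : nat -> set T2) :
  open_base U -> open_base V -> forall A : set (T1 * T2), open A ->
  measurable (A : set (borelT T1 * borelT T2)%type).
Proof.
move=> bU bV A oA.
(* [F p] is the box with index [p] when that box lies in [A], and empty otherwise. *)
pose F (p : nat * nat) : set (borelT T1 * borelT T2) :=
  [set z | [/\ U p.1 z.1, V p.2 z.2 & U p.1 `*` V p.2 `<=` A]].
suff -> : A = \bigcup_p F p.
  apply: countable_bigcupT_measurable; first exact: countableP.
  move=> [i j]; have [sA|nA] := pselect (U i `*` V j `<=` A).
    suff -> : F (i, j) = (U i : set (borelT T1)) `*` (V j : set (borelT T2)).
      apply: measurableX; apply: sub_sigma_algebra.
        by case: bU.
      by case: bV.
    by apply/seteqP; split=> -[a b]; rewrite /F /=; [case|case].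
  suff -> : F (i, j) = set0 by exact: measurable0.
  by rewrite -subset0 => z [].
apply/seteqP; split; last first.
  by move=> [a b] [[i j] _ [/= Ua Vb]]; apply.
move=> [x y] Axy.
have [i [j [Ui Vj sA]]] := open_base_box bU bV oA Axy.
by exists (i, j).
Qed.

Lemma continuous_borel_measurable (T T' : ptopologicalType) (f : T -> T') :
  continuous f -> measurable_fun setT (f : borelT T -> borelT T').
Proof.
move=> cf; apply: (@measurability _ _ (borelT T) (borelT T') _ _
  (@open T')) => //.
move=> _ [A oA <-]; rewrite setTI; apply: sub_sigma_algebra.
by move/continuousP: cf; apply.
Qed.

Lemma borel_preimage (T T' : ptopologicalType) (f : T -> T') (A : set T') :
  continuous f -> borel A -> borel (f @^-1` A).
Proof.
move=> cf bA; rewrite -[X in borel X]setTI.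
exact: (continuous_borel_measurable cf).
Qed.

Lemma continuous_prod_measurable (T1 T2 T' : ptopologicalType)
    (U : nat -> set T1) (V : nat -> set T2)
    (f : T1 * T2 -> T') : open_base U -> open_base V ->
  continuous f ->
  measurable_fun setT (f : (borelT T1 * borelT T2)%type -> borelT T').
Proof.
move=> bU bV cf; apply: (@measurability _ _ (borelT T1 * borelT T2)%type
  (borelT T') _ _
  (@open T')) => //.
move=> _ [A oA <-]; rewrite setTI.
by apply: (open_prod_measurable bU bV); move/continuousP: cf; apply.
Qed.

(** * Fubini, null sets and sigma-finiteness *)

Local Open Scope ereal_scope.

(** Bundles sigma-finiteness with the measure, the form in which Fubini takes it. *)
Lemma sigma_finite_pack d (T : measurableType d) (R : realType)
    (m : {measure set T -> \bar R}) : sigma_finite setT m ->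
  exists m' : {sigma_finite_measure set T -> \bar R},
    m' = m :> (set T -> \bar R).
Proof.
move=> sm.
pose H2 := isSFinite.Build _ _ _ _ (sfinite_measure_sigma_finite sm).
pose H3 := isSigmaFinite.Build _ _ _ _ sm.
by exists (HB.pack_for (SigmaFiniteMeasure.type T R) (Measure.sort m) H2 H3).
Qed.

(** By Tonelli the nonnegative function [y |-> m1 (ysection W y)] has integral zero, so it vanishes
    almost everywhere. *)
Lemma fubini_null d1 d2 (T1 : measurableType d1) (T2 : measurableType d2)
    (R : realType) (m1 : {sigma_finite_measure set T1 -> \bar R})
    (m2 : {sigma_finite_measure set T2 -> \bar R}) (W : set (T1 * T2)) :
  measurable W -> (forall x, m2 (xsection W x) = 0) ->
  m2 [set y | m1 (ysection W y) != 0] = 0.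
Proof.
move=> mW W0.
pose f : T2 -> \bar R := fun y => m1 (ysection W y).
have mf : measurable_fun setT f by exact: measurable_fun_ysection.
have : \int[m2]_y f y = 0.
  rewrite -[f](indic_fubini_tonelli_GE m1 mW).
  rewrite -(indic_fubini_tonelli m1 m2 mW) indic_fubini_tonelli_FE//.
  by apply: integral0_eq => x _ /=; exact: W0.
rewrite (eq_integral (fun y => `|f y|)); last first.
  by move=> y _; rewrite gee0_abs// /f.
move/(ae_eq_integral_abs _ measurableT mf) => -[N [mN N0 sN]].
apply/negligibleP.
  by have := emeasurable_neq measurableT mf 0; rewrite setTI.
by exists N; split=> // y /= /eqP y0; apply: sN => /= /(_ I).
Qed.

(** Some piece of a sigma-finite cover has positive finite measure; normalizing the restriction to
    it gives [P]. *)
Lemma exists_abs_cont_probability d (T : measurableType d) (R : realType)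
    (m : {measure set T -> \bar R}) : sigma_finite setT m -> 0 < m setT ->
  exists P : probability T R, forall A, measurable A -> m A = 0 -> P A = 0.
Proof.
move=> [F TF mF] mT.
have [i Fi0] : exists i, m (F i) != 0.
  apply: contrapT => /forallNP F0; move: mT; rewrite lt0e => /andP[/eqP + _].
  apply; apply/negligibleP => //; rewrite TF.
  apply: negligible_bigcup => k; apply/negligibleP; first by case: (mF k).
  by apply/eqP; apply: contrapT => /negP; exact: F0.
have [mFi Fioo] := mF i.
(* The Dirac mass is the fallback for total mass zero or infinite, both excluded below. *)
exists (mnormalize (mrestr m mFi) (dirac point)) => A mA A0.
have AFi0 : m (A `&` F i) = 0.
  by apply: (@subset_measure0 _ _ _ m _ A) => //; exact: measurableI.
have FE : m ([set: T] `&` F i) = m (F i) by rewrite setTI.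
rewrite /= /mnormalize; case: ifPn => [/orP[/eqP E|/eqP E]|_].
- by move: Fi0; rewrite -FE => /eqP; case.
- by move: Fioo; rewrite -FE => /lt_eqF/eqP; case.
- by rewrite -[LHS]/(m (A `&` F i) * _) AFi0 mul0e.
Qed.

(** The basic open sets contained in a compact set still cover the space, and they have finite
    measure. *)
Lemma loc_compact_sigma_finite (R : realType) (T : ptopologicalType)
    (U : nat -> set T)
    (m : {measure set (borelT T) -> \bar R}) :
  open_base U -> hausdorff_space T -> loc_compact T ->
  (forall K : set T, compact K -> m K < +oo) -> sigma_finite setT m.
Proof.
move=> [oU bU] hT lcT mK.
pose cU n := exists K : set T, compact K /\ U n `<=` K.
have mU n : measurable (U n : set (borelT T)) by exact: sub_sigma_algebra.
exists (fun n => if `[< cU n >] then U n else set0).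
  apply/seteqP; split=> // x _; have [K [cK]] := lcT x.
  rewrite nbhsE => -[A [oA Ax] AK].
  have [n Unx UnA] := bU _ _ oA Ax.
  exists n => //; rewrite asboolT//; exists K; split=> //.
  exact: subset_trans UnA AK.
move=> n; case: asboolP => [[K [cK UK]]|_]; last by rewrite measure0.
split; first exact: mU.
apply: le_lt_trans (mK _ cK); apply: le_measure => //; rewrite inE //.
rewrite -(setCK K); apply: measurableC; apply: sub_sigma_algebra.
by apply: closed_openC; apply: compact_closed.
Qed.

(** * Group identities, translates and continuity *)

Section group.
Variables (T : Type) (mul : T -> T -> T) (inv : T -> T) (one : T).
Hypothesis hT : is_group mul inv one.

Lemma gmulKV x y : mul x (mul (inv x) y) = y.
Proof. by case: hT => A L _ _ V; rewrite A V L. Qed.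

Lemma gmulVK x y : mul (inv x) (mul x y) = y.
Proof. by case: hT => A L _ V _; rewrite A V L. Qed.

Lemma gmulK x y : mul (mul y x) (inv x) = y.
Proof. by case: hT => A _ Rt _ V; rewrite -A V Rt. Qed.

Lemma ginv_eq x y : mul x y = one -> inv x = y.
Proof. by case: hT => A L Rt V _ E; rewrite -(Rt (inv x)) -E A V L. Qed.

Lemma ginvK x : inv (inv x) = x.
Proof. by apply: ginv_eq; case: hT. Qed.

Lemma ginvM x y : inv (mul x y) = mul (inv y) (inv x).
Proof.
by apply: ginv_eq; case: hT => A L Rt V W; rewrite A -(A x) W Rt W.
Qed.

(** Writing translates as preimages reduces their measurability to continuity of the group
    operations. *)
Lemma lefttranslateE x (A : set T) :
  [set mul x a | a in A] = [set g | A (mul (inv x) g)].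
Proof.
apply/seteqP; split=> [_ [a Aa <-] /=|g Ag]; first by rewrite gmulVK.
by exists (mul (inv x) g); rewrite ?gmulKV.
Qed.

Lemma twosidedE x (A : set T) y :
  twosided mul x A y = [set g | A (mul (mul (inv x) g) (inv y))].
Proof.
case: hT => As _ Rt V _.
apply/seteqP; split=> [_ [a Aa <-] /=|g Ag].
  by rewrite -(As x a y) gmulVK gmulK.
exists (mul (mul (inv x) g) (inv y)) => //.
by rewrite -(As (inv x)) gmulKV -As V Rt.
Qed.

End group.

Lemma prod_is_group (G H : Type) mulG invG oneG mulH invH oneH :
  @is_group G mulG invG oneG -> @is_group H mulH invH oneH ->
  is_group (prod_mul mulG mulH) (fun p => (invG p.1, invH p.2)) (oneG, oneH).
Proof.
move=> [A L Rt V W] [A' L' Rt' V' W'].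
split=> [[? ?] [? ?] [? ?]|[? ?]|[? ?]|[? ?]|[? ?]];
  rewrite /prod_mul /=.
- by rewrite A A'.
- by rewrite L L'.
- by rewrite Rt Rt'.
- by rewrite V V'.
- by rewrite W W'.
Qed.

Lemma continuous_pair (T T1 T2 : topologicalType) (f : T -> T1) (g : T -> T2) :
  continuous f -> continuous g -> continuous (fun x => (f x, g x)).
Proof. by move=> cf cg x; apply: cvg_pair; [exact: cf|exact: cg]. Qed.

Lemma continuous_mul2 (T S : topologicalType) (mul : T -> T -> T)
    (f g : S -> T) :
  continuous (fun p : T * T => mul p.1 p.2) -> continuous f -> continuous g ->
  continuous (fun x => mul (f x) (g x)).
Proof.
move=> cm cf cg x.
by apply: (continuous_comp (@continuous_pair _ _ _ _ _ cf cg x) (cm _)).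
Qed.

(** * Null sets of a left-invariant measure *)

(* Fubini on [{(g, h) : g^-1 h \in S}]: the [g]-sections are the left translates
   [g S], and all [h]-sections [h S^-1] have the measure of [S^-1]. *)
Lemma haar_inverse_null (R : realType) (G : ptopologicalType)
    mul inv one (U : nat -> set G)
    (lam : {sigma_finite_measure set (borelT G) -> \bar R}) (S : set G) :
  is_group mul inv one -> continuous (fun p : G * G => mul p.1 p.2) ->
  continuous inv -> open_base U -> 0 < lam setT ->
  (forall g A, borel A -> lam [set mul g a | a in A] = lam A) ->
  borel S -> lam S = 0 -> lam [set g | S (inv g)] = 0.
Proof.
move=> gG cm ci bU lT linv bS S0.
pose W : set (borelT G * borelT G) := [set p | S (mul (inv p.1) p.2)].
have mW : measurable W.
  rewrite -[W]setTI.
  apply: (continuous_prod_measurable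
    (f := fun p => mul (inv p.1) p.2) bU bU) => //.
  apply: continuous_mul2 => //; last by move=> ?; exact: cvg_snd.
  by move=> x; apply: continuous_comp; [exact: cvg_fst|exact: ci].
have mSi : borel [set g | S (inv g)].
  exact: borel_preimage.
have := fubini_null lam (m2 := lam) mW.
case: (eqVneq (lam [set g | S (inv g)]) 0) => [//|Si0].
have lamW y : lam (ysection W y) = lam [set g | S (inv g)].
  rewrite -[RHS](linv y) // (lefttranslateE gG); congr (lam _).
  apply/seteqP; split=> x /=; rewrite ysectionE /W /=.
    by rewrite (ginvM gG) (ginvK gG).
  by rewrite (ginvM gG) (ginvK gG).
(* If [S^-1] had positive measure, every [y] would lie in the exceptional set of Fubini, which is
   null, whereas [lam setT] is positive. *)
move=> H0; move: lT; rewrite (_ : setT = [set y | lam (ysection W y) != 0]).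
  rewrite H0 ?ltxx// => x.
  rewrite -[RHS]S0 -(linv x S) // (lefttranslateE gG) xsectionE.
  by [].
by apply/seteqP; split=> y //= _; rewrite lamW.
Qed.

(** The set [S y^-1] equals [(y S^-1)^-1]: inversion preserves Borel null sets and left translation
    preserves the measure. *)
Lemma haar_right_translate_null (R : realType) (G : ptopologicalType)
    mul inv one (U : nat -> set G)
    (lam : {sigma_finite_measure set (borelT G) -> \bar R})
    (S : set G) y :
  is_group mul inv one -> continuous (fun p : G * G => mul p.1 p.2) ->
  continuous inv -> open_base U -> 0 < lam setT ->
  (forall g A, borel A -> lam [set mul g a | a in A] = lam A) ->
  borel S -> lam S = 0 -> lam [set g | S (mul g y)] = 0.
Proof.
move=> gG cm ci bU lT linv bS S0.
have bI A : borel A -> borel [set g | A (inv g)] by exact: borel_preimage.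
have bM A : borel A -> borel [set mul y a | a in A].
  rewrite (lefttranslateE gG).
  apply: (borel_preimage (f := fun g => mul (inv y) g)).
  by apply: continuous_mul2 => //; move=> ?; [exact: cvg_cst|exact: cvg_id].
have := haar_inverse_null gG cm ci bU lT linv.
move=> inv0.
transitivity
    (lam [set g | [set mul y a | a in [set g | S (inv g)]] (inv g)]); last first.
  apply: (inv0 [set mul y a | a in [set g | S (inv g)]]).
    by apply: bM; exact: bI.
  by rewrite (linv _ _ (bI _ bS)); exact: inv0.
congr (lam _).
rewrite (lefttranslateE gG); apply/seteqP; split=> x /=.
  by rewrite (ginvM gG) !(ginvK gG).
by rewrite (ginvM gG) !(ginvK gG).
Qed.

(** * Sections and Haar null sets in a product group *)

(** Used to pass from the product sigma-algebra to the Borel one along the identity, and to project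
    a measure to [H]. *)
Lemma exists_pushforward_probability d1 d2 (T1 : measurableType d1)
    (T2 : measurableType d2) (R : realType) (P : probability T1 R)
    (f : T1 -> T2) : measurable_fun setT f ->
  exists Q : probability T2 R, forall A, Q A = P (f @^-1` A).
Proof.
move=> mf; pose F := isMeasurableFun.Build _ _ _ _ f mf.
pose X : {mfun T1 >-> T2} := HB.pack f F.
by exists (distribution P X).
Qed.

Lemma hsection_borel (G H : ptopologicalType) (B : set (G * H)) h :
  borel B -> borel (hsection B h).
Proof.
apply: (borel_preimage (f := fun g : G => (g, h))).
by apply: continuous_pair; [move=> ?; exact: cvg_id|move=> ?; exact: cvg_cst].
Qed.

Lemma borel_prod_measurable (G H : ptopologicalType)
    (U : nat -> set G) (V : nat -> set H) (B : set (G * H)) :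
  open_base U -> open_base V -> borel B ->
  measurable (B : set (borelT G * borelT H)%type).
Proof.
move=> bU bV bB; rewrite -[B]setTI.
by apply: (continuous_prod_measurable (f := id) bU bV) => // x; exact: cvg_id.
Qed.

Lemma haar_null_of_sections (R : realType) (G H : ptopologicalType)
    mulG invG oneG mulH invH oneH (B : set (G * H)) :
  polish_group R mulG invG oneG -> polish_group R mulH invH oneH -> borel B ->
  forall (E : set H) (mu : probability (borelT G) R), haar_null R mulH E ->
  (forall h, ~ E h -> forall g1 g2,
     mu (twosided mulG g1 (hsection B h) g2) = 0) ->
  haar_null R (prod_mul mulG mulH) B.
Proof.
move=> [gG cmG ciG sG mG] [gH cmH ciH sH mH] bB E mu.
move=> [E' [bE' EE' [nu nu0]]] mu0.
have [U bU] := polish_base sG mG.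
have [V bV] := polish_base sH mH.
exists B; split=> //.
have mid : measurable_fun setT
    (id : (borelT G * borelT H)%type -> borelT (G * H)%type).
  by apply: (continuous_prod_measurable (f := id) bU bV) => x; exact: cvg_id.
(* [\x^] computes the measure of a set from its sections over [H], matching [hsection]. *)
have [Q QE] := exists_pushforward_probability (mu \x^ nu) mid.
exists Q => x y; rewrite QE.
rewrite (twosidedE (prod_is_group gG gH)) /=.
(* The preimage [C] is the translate [x B y]; its section over [h] is a two-sided translate of the
   section of [B] over [x.2^-1 h y.2^-1]. *)
pose c (p : G * H) := prod_mul mulG mulH
  (prod_mul mulG mulH (invG x.1, invH x.2) p) (invG y.1, invH y.2).
pose C := c @^-1` B; rewrite -[LHS]/((mu \x^ nu) C).
have bC : borel C.
  apply: borel_preimage => //.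
  apply: continuous_pair.
    apply: continuous_mul2 => //; last by move=> ?; exact: cvg_cst.
    by apply: continuous_mul2 => // ?; [exact: cvg_cst|exact: cvg_fst].
  apply: continuous_mul2 => //; last by move=> ?; exact: cvg_cst.
  by apply: continuous_mul2 => // ?; [exact: cvg_cst|exact: cvg_snd].
have mC := borel_prod_measurable bU bV bC.
rewrite /product_measure2.
pose f : borelT H -> \bar R := fun h => mu (ysection C h).
have mf : measurable_fun setT f by exact: measurable_fun_ysection.
rewrite -[LHS]/(\int[nu]_h f h) (eq_integral (fun h => `|f h|)); last first.
  by move=> h _; rewrite gee0_abs// /f.
apply/(ae_eq_integral_abs _ measurableT mf).
have bE : borel (twosided mulH x.2 E' y.2).
  rewrite (twosidedE gH).
  apply: (borel_preimage
    (f := fun h => mulH (mulH (invH x.2) h) (invH y.2))) => //.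
  apply: continuous_mul2 => //; last by move=> ?; exact: cvg_cst.
  by apply: continuous_mul2 => // ?; [exact: cvg_cst|exact: cvg_id].
(* Off this [nu]-null set, [x.2^-1 h y.2^-1] avoids [E'], hence [E], and [mu0] applies. *)
exists (twosided mulH x.2 E' y.2); split; [exact: bE|exact: nu0|].
move=> h /= /not_implyP[_ fh].
rewrite (twosidedE gH) /=; apply: contrapT => nE.
apply: fh; have := mu0 _ (fun e => nE (EE' _ e)) x.1 y.1.
rewrite (twosidedE gG) => <-; rewrite /f ysectionE.
by [].
Qed.

(** The core of (2) => (3), to be applied to the Borel superset that witnesses (2). *)
Lemma haar_null_sections (R : realType) (G H : ptopologicalType)
    mulG invG oneG mulH invH oneH (B : set (G * H))
    (lam : {sigma_finite_measure set (borelT G) -> \bar R}) :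
  polish_group R mulG invG oneG -> polish_group R mulH invH oneH ->
  (forall g A, borel A -> lam [set mulG g a | a in A] = lam A) ->
  borel B ->
  forall nu : probability (borelT (G * H)%type) R,
  (forall x y, nu (twosided (prod_mul mulG mulH) x B y) = 0) ->
  haar_null R mulH [set h | lam (hsection B h) != 0].
Proof.
move=> [gG cmG ciG sG mG] [gH cmH ciH sH mH] linv bB nu nu0.
have [U bU] := polish_base sG mG.
have [V bV] := polish_base sH mH.
have [W bW] := prod_base bU bV.
exists [set h | lam (hsection B h) != 0]; split=> //.
  (* The measure of the section depends measurably on [h], so the exceptional set is Borel and
     serves as its own Borel superset. *)
  have mB := borel_prod_measurable bU bV bB.
  pose f : borelT H -> \bar R := fun h => lam (ysection B h).
  have mf : measurable_fun setT f by exact: measurable_fun_ysection.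
  have := emeasurable_neq measurableT mf 0.
  rewrite setTI (_ : [set h | f h != 0] = [set h | lam (hsection B h) != 0])//.
  by apply/seteqP; split=> h /=; rewrite /f ysectionE.
have msnd : measurable_fun setT (snd : borelT (G * H)%type -> borelT H).
  by apply: continuous_borel_measurable => x; exact: cvg_snd.
have [Q QE] := exists_pushforward_probability nu msnd.
exists Q => x y; rewrite QE (twosidedE gH).
(* Fixing [(a, b)] leaves a left translation by [a] on [G]; fixing [g] leaves a two-sided
   translation of [G * H]. *)
pose t (p : G * (G * H)) : G * H :=
  (mulG p.2.1 p.1, mulH (mulH (invH x) p.2.2) (invH y)).
have mt : measurable_fun setT
    (t : (borelT G * borelT (G * H)%type)%type -> borelT (G * H)%type).
  have c2 : continuous (fun p : G * (G * H) => p.2) by move=> ?; exact: cvg_snd.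
  apply: (continuous_prod_measurable bU bW).
  apply: continuous_pair; apply: continuous_mul2 => //.
  - by move=> z; apply: (continuous_comp (c2 z)); exact: cvg_fst.
  - by move=> ?; exact: cvg_fst.
  - apply: continuous_mul2 => //; first by move=> ?; exact: cvg_cst.
    by move=> z; apply: (continuous_comp (c2 z)); exact: cvg_snd.
  - by move=> ?; exact: cvg_cst.
have mtB : measurable (t @^-1` B : set (borelT G * borelT (G * H)%type)%type).
  by rewrite -[X in measurable X]setTI; exact: mt.
(* By left invariance the value does not depend on [a], so the exceptional pairs form the preimage
   under [snd] of the translate by [x] and [y]. *)
have lamE a b : lam (ysection (t @^-1` B) (a, b)) =
    lam (hsection B (mulH (mulH (invH x) b) (invH y))).
  rewrite -[RHS](linv (invG a)); last exact: hsection_borel.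
  rewrite (lefttranslateE gG) (ginvK gG) ysectionE.
  by [].
rewrite -[RHS](fubini_null lam (m2 := nu) mtB).
  by congr (nu _); apply/seteqP; split=> -[a b] /=; rewrite lamE.
(* The section over [g] is the translate of [B] by [(oneG, x)] and [(g^-1, y)], null by [nu0]. *)
move=> g; rewrite -[RHS](nu0 (oneG, x) (invG g, y)).
rewrite (twosidedE (prod_is_group gG gH)) /=.
have oneK a : mulG (invG oneG) a = a.
  rewrite (@ginv_eq _ _ _ _ gG oneG oneG); by case: gG.
rewrite xsectionE; congr (nu _); apply/seteqP; split=> -[a b] /=;
  by rewrite /prod_mul /t /= oneK (ginvK gG).
Qed.

(** * Equivalence of the three conditions *)

Unset Implicit Arguments.

Theorem theorem5p4 (R : realType) (G H : ptopologicalType)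
  (mulG : G -> G -> G) (invG : G -> G) (oneG : G)
  (mulH : H -> H -> H) (invH : H -> H) (oneH : H)
  (hG : polish_group R mulG invG oneG) (hH : polish_group R mulH invH oneH)
  (B : set (G * H)) (hB : borel B) :
  let cond1 := exists E : set H, haar_null R mulH E /\
      exists mu : probability (borelT G) R,
        forall h : H, ~ E h -> forall g1 g2 : G,
          mu (twosided mulG g1 (hsection B h) g2) = 0%E in
  let cond2 := haar_null R (prod_mul mulG mulH) B in
  (cond1 -> cond2) /\
  (loc_compact G ->
   forall lam : {measure set (borelT G) -> \bar R},
     left_haar_measure mulG lam ->
     let cond3 := exists E : set H, haar_null R mulH E /\
         forall h : H, ~ E h -> haar_measure_zero lam (hsection B h) in
     (cond1 <-> cond2) /\ (cond2 <-> cond3)).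
Proof.
move=> cond1 cond2.
have c12 : cond1 -> cond2.
  by move=> [E [nE [mu mu0]]]; exact: (haar_null_of_sections hG hH hB nE mu0).
split=> // lcG lam [lT linv lK _ _] cond3.
have [gG cmG ciG sG mG] := hG.
have [U bU] := polish_base sG mG.
have slam := loc_compact_sigma_finite bU
  (metrizable_hausdorff mG) lcG lK.
have [l lE] := sigma_finite_pack slam.
have linv' g A : borel A -> l [set mulG g a | a in A] = l A.
  by rewrite lE; exact: linv.
have c23 : cond2 -> cond3.
  move=> [B' [bB' BB' [nu nu0]]].
  (* [B'] replaces [B], since the sections of [B] lie in those of [B']. *)
  exists [set h | l (hsection B' h) != 0]; split.
    exact: (haar_null_sections hG hH linv' bB' nu0).
  move=> h /= /negP; rewrite negbK lE => /eqP l0.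
  exists (hsection B' h) => //; split; first exact: hsection_borel.
  by move=> g; exact: BB'.
have c31 : cond3 -> cond1.
  move=> [E [nE E0]]; exists E; split=> //.
  (* [mu] is chosen before [h]: it vanishes on all [lam]-null Borel sets at once. *)
  have [mu mu0] := exists_abs_cont_probability slam lT.
  exists mu => h /E0[S [bS BS] S0] g1 g2.
  have bBh := hsection_borel h hB.
  have l0 : l (hsection B h) = 0.
    by rewrite lE; exact: (@subset_measure0 _ _ _ lam _ S bBh bS BS S0).
  rewrite (twosidedE gG).
  (* The translation is split: the right one by [g2] preserves null sets, the left one by [g1]
     preserves [lam]. *)
  rewrite (_ : [set _ | _] = [set mulG g1 a | a in
    [set g | hsection B h (mulG g (invG g2))]]); last first.
    by rewrite (lefttranslateE gG).
  have bT : borel [set g | hsection B h (mulG g (invG g2))].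
    apply: (borel_preimage (f := fun g => mulG g (invG g2))) => //.
    by apply: continuous_mul2 => // ?; [exact: cvg_id|exact: cvg_cst].
  apply: mu0.
    rewrite (lefttranslateE gG).
    apply: (borel_preimage (f := fun g => mulG (invG g1) g)) => //.
    by apply: continuous_mul2 => // ?; [exact: cvg_cst|exact: cvg_id].
  rewrite linv// -lE.
  apply: (haar_right_translate_null (invG g2) gG cmG ciG bU) => //.
  by rewrite lE.
(* The cycle (1) => (2) => (3) => (1) gives both equivalences. *)
split; split=> //.
- by move=> /c23/c31.
- by move=> /c31/c12.
Qed.
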